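(* Let $G$ be a finite group. Then $G$ is a primitive $9$-centralizer group if and only if $\frac{G}{Z(G)}\cong C_7 \rtimes C_2$ or $\frac{G}{Z(G)}\cong C_7 \rtimes C_3$ or $\frac{G}{Z(G)}\cong (C_6, C_7)$.
   Context: For a finite group $G$, $Z(G)$ denotes the center of $G$, and for $x\in G$, $C(x)$ denotes the centralizer of $x$ in $G$. Let $Cent(G)=\{C(x)\mid x\in G\}$ be the set of distinct centralizers of elements of $G$. The group $G$ is called primitive $n$-centralizer if $|Cent(G)|=|Cent(\frac{G}{Z(G)})|=n$, where $Cent(\frac{G}{Z(G)})$ is the set of distinct centralizers of elements of the group $\frac{G}{Z(G)}$, taken in $\frac{G}{Z(G)}$. $C_n$ denotes the cyclic group of order $n$. $C_7\rtimes C_2$ and $C_7\rtimes C_3$ denote the semidirect products, with normal subgroup $C_7$ and nontrivial action, i.e. the non-abelian groups of order $14$ and $21$ respectively (each unique up to isomorphism). $(C_6,C_7)$ denotes the Frobenius group with complement $C_6$ and kernel $C_7$ (of order $42$, unique up to isomorphism). *)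

(* Defs.v *)
From mathcomp Require Import all_boot all_fingroup all_solvable.

Set Implicit Arguments.
Unset Strict Implicit.
Unset Printing Implicit Defensive.

Local Open Scope group_scope.

Definition Cent (gT : finGroupType) (G : {set gT}) : {set {set gT}} :=
  [set 'C_G[x] | x in G].

(* The centralizers of G / 'Z(G) are taken inside the quotient group, not
   obtained as images of centralizers of G. *)
Definition primitive_centralizer (gT : finGroupType) (n : nat) (G : {set gT}) :
    Prop :=
  #|Cent G| = n /\ #|Cent (G / 'Z(G))| = n.

(* Q is isomorphic to a semidirect product C_m ><| C_k with nontrivial action:
   the isomorphism is expressed through the internal semidirect product, whose
   action of H on K is conjugation, trivial exactly when H centralises K. *)
Definition is_cyclic_sdprod (gT : finGroupType) (m k : nat) (Q : {set gT}) :
    Prop :=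
  exists K H : {group gT},
    [/\ K ><| H = Q,
        cyclic K /\ #|K| = m,
        cyclic H /\ #|H| = k
      & ~~ (H \subset 'C(K))].

(* Q is isomorphic to the Frobenius group (C_k, C_m), written with the
   complement C_k first and the kernel C_m second. *)
Definition is_cyclic_Frobenius (gT : finGroupType) (k m : nat) (Q : {set gT}) :
    Prop :=
  exists K H : {group gT},
    [/\ [Frobenius Q = K ><| H],
        cyclic K /\ #|K| = m
      & cyclic H /\ #|H| = k].

(* Main.v *)
Require Import Defs.
From mathcomp Require Import all_boot all_fingroup all_solvable zify.

(** Write Z for the center of G and Q for G / Z.

    From the centralizer counts to the structure of Q. Suppose first that some
    noncentral x has a nonabelian centralizer H. The centralizers C(h) with h in
    H contain x, those C(g) with g outside H do not, so the two kinds can be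
    counted separately. There are at least five of the first kind: G, H, and
    C(y), C(y'), C(y y') for noncommuting y, y' in H. As for the second kind,
    the abelian groups Z(C(g)) cover G \ H, and such a group A meets H in a
    proportion of A no smaller than that of H in G; so if all of them have index
    at least m in G, there are at least m of them. The index is at least 4
    because an abelian subgroup of index 2 or 3 either equals H or meets it in a
    central subgroup of index at most 3, and then H would be abelian. This gives
    nine centralizers, and one more is always present: either some noncentral z
    in H commutes with an element outside H, which adds a centralizer of the
    first kind ([inner_ge6]), or every Z(C(g)) meets H in Z, which raises the
    index to 8. Hence a group with nine centralizers has all its proper
    centralizers abelian ([card_Cent_nonabelian]).

    Two such centralizers are then equal or meet in Z, so their images cut Q into
    eight abelian subgroups with trivial pairwise intersections. The orders of
    two components have product at most |Q|, and adding this up over the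
    components bounds every order by 7 ([part_order_leq7]). For each prime p, Frobenius'
    theorem makes the number of p-elements, which is read off the orders of the
    components, a multiple of the p-part of |Q|. Only five distributions of
    orders pass these tests ([admissible_profiles]). Eight components of order 7
    would give |Q| = 49 and Q abelian, with a single centralizer instead of nine.
    In the others one component K is alone of its order, hence
    normal, and a component of complementary coprime order acts on it without
    fixed points, because commuting elements of coprime orders lie in a common
    component. So Q is a Frobenius group ([part_Frobenius]): of order 14, 21 or
    42 with kernel of order 7, or of order 20, where the five conjugates of a
    complement exceed the four components of order 4.

    Conversely, the three groups are Frobenius with cyclic kernel K of order 7
    and cyclic complement H. Their centralizers are Q, K and the seven conjugates
    of H, nine in all ([card_Cent_Frobenius]). The proper ones are cyclic, so
    their preimages in G are abelian; this makes C_G(x) the whole preimage of the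
    centralizer of the image of x, and G has as many centralizers as Q
    ([card_Cent_quotient]). *)

Set Implicit Arguments.
Unset Strict Implicit.
Unset Printing Implicit Defensive.

Local Open Scope group_scope.

(** * Groups with a nonabelian proper centralizer *)

Lemma leq_card_bigcup (I T : finType) (J : {set I}) (F : I -> {set T}) :
  #|\bigcup_(i in J) F i| <= \sum_(i in J) #|F i|.
Proof.
elim/big_rec2: _ => [|i n A _ leAn]; first by rewrite cards0.
by rewrite (leq_trans (leq_card_setU _ _)) ?leq_add2l.
Qed.

Lemma mul_cardG_leq (gT : finGroupType) (G A B : {group gT}) :
  A \subset G -> B \subset G -> #|A| * #|B| <= #|G| * #|A :&: B|.
Proof.
move=> sAG sBG.
by rewrite mul_cardG leq_mul2r subset_leq_card ?orbT ?mul_subG.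
Qed.

(** If the abelian subgroup A had index 2 or 3, it would be maximal. Then either
    x lies in A and A is its whole centralizer, or A and x generate G, and the
    centralizer of x modulo its central intersection with A has order at most 3,
    hence is cyclic. *)
Lemma abelian_index_ge4 (gT : finGroupType) (G A : {group gT}) (x : gT) :
    A \subset G -> abelian A -> x \in G -> x \notin 'Z(G) ->
    ~~ abelian 'C_G[x] -> 4 * #|A| <= #|G|.
Proof.
move=> sAG abA Gx ZGx; rewrite leqNgt; apply: contra => ltGA.
have sCG: 'C_G[x] \subset G by rewrite subsetIl.
have gt0A := cardG_gt0 A.
have [defG | neAG] := eqVneq (A : {set gT}) G.
  by apply: (abelianS sCG); rewrite -defG.
(* An index below 4 is prime, so no subgroup lies strictly between A and G. *)
have pr_iGA: prime #|G : A|.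
  have lt4: #|G : A| < 4 by rewrite -(ltn_pmul2l gt0A) Lagrange // mulnC.
  have: 1 < #|G : A|.
    by rewrite indexg_gt1; apply: contra neAG => sGA; rewrite eqEsubset sAG.
  by case: #|_ : _| lt4 => [|[|[|[|]]]].
have /maximal_eqP[_ maxA]: maximal_eq A G.
  by rewrite /maximal_eq p_index_maximal ?orbT.
have [Ax | nAx] := boolP (x \in A).
  have sAC: A \subset 'C_G[x].
    by rewrite subsetI sAG sub_cent1 (subsetP abA).
  have [-> //| defC] := maxA ('C_G[x])%G sAC sCG.
  by case/negP: ZGx; rewrite inE Gx /= -sub_cent1 -{1}defC subsetIr.
have defG: A <*> <[x]> = G.
  have [||defA|defG] := maxA (A <*> <[x]>)%G.
  - by rewrite joing_subl.
  - by rewrite join_subG sAG cycle_subG.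
  - by case/negP: nAx; rewrite -defA mem_gen // inE cycle_id orbT.
  exact: defG.
(* G is generated by A and x, so the part of A that commutes with x is central. *)
have sIZ: 'C_G[x] :&: A \subset 'Z('C_G[x]).
  rewrite subsetI subsetIl; apply/centsP=> y.
  case/setIP=> /setIP[Gy cxy] Ay z /setIP[Gz _].
  have: y \in 'C(G) by rewrite -defG centY inE (subsetP abA) //= cent_cycle.
  by move/centP/(_ z Gz).
have nIC := sub_center_normal sIZ.
apply: (cyclic_factor_abelian sIZ); apply: cyclic_small.
rewrite card_quotient ?normal_norm // -ltnS.
rewrite -(ltn_pmul2l (cardG_gt0 ('C_G[x] :&: A))) Lagrange ?subsetIl //.
rewrite -(ltn_pmul2r gt0A) (leq_ltn_trans (mul_cardG_leq sCG sAG)) //.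
by rewrite mulnC -mulnA ltn_pmul2l ?cardG_gt0.
Qed.

(** The factor 8 is 4 * 2: a nonabelian group modulo its center is not cyclic, so
    has order at least 4, and x itself is central in its centralizer but not
    in G. *)
Lemma card_nonabelian_cent1 (gT : finGroupType) (G : {group gT}) (x : gT) :
    x \in G -> x \notin 'Z(G) -> ~~ abelian 'C_G[x] -> 8 * #|'Z(G)| <= #|'C_G[x]|.
Proof.
move=> Gx ZGx nabC.
have sZ: 'Z(G) \subset 'Z('C_G[x]).
  rewrite subsetI; apply/andP; split.
    by rewrite setIS // -cent_set1 centS // sub1set.
  by rewrite subIset // orbC centS // subsetIl.
have iZ: 1 < #|'Z('C_G[x]) : 'Z(G)|.
  rewrite indexg_gt1; apply: contra ZGx => /subsetP; apply.
  rewrite inE inE Gx cent1id /=; apply/centP=> y /setIP[_].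
  by move/cent1P.
have iC: 3 < #|'C_G[x] : 'Z('C_G[x])|.
  rewrite ltnNge; apply: contra nabC => le3; apply: cyclic_center_factor_abelian.
  by apply: cyclic_small; rewrite card_quotient ?normal_norm ?center_normal.
rewrite -(Lagrange (center_sub 'C_G[x])) -(Lagrange sZ).
rewrite -[8]/(2 * 4)%N mulnC -mulnA leq_mul2l leq_mul ?orbT //.
Qed.

(** Sets with different membership patterns on a list of test points are
    distinct; this reduces counting centralizers to a table of commutation
    relations. *)
Lemma card_separated (T : finType) (I : {set {set T}}) (ws : seq T)
    (s : seq {set T}) :
    {subset s <= I} -> uniq [seq [seq w \in C | w <- ws] | C : {set T} <- s] ->
  size s <= #|I|.
Proof.
move=> sI /map_uniq Us; rewrite cardE; apply: uniq_leq_size => // C sC.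
by rewrite mem_enum sI.
Qed.

(** Used with q, h, a the orders of a group, of a subgroup H and of a subgroup A,
    and with i, d the numbers of elements of A inside and outside H: the share of
    A lying outside H is at most the share of the whole group outside H. *)
Lemma leq_outside (q h a i d m : nat) :
    0 < q -> h <= q -> i + d = a -> a * h <= q * i -> m * a <= q ->
  m * d <= q - h.
Proof.
move=> q0 hq eqa ah ma; rewrite -(leq_pmul2l q0).
have qd: q * d <= a * (q - h) by rewrite mulnBr -eqa mulnDl; nia.
by rewrite mulnCA (leq_trans (leq_mul (leqnn m) qd)) // mulnA leq_mul.
Qed.

Section NonabelianCentralizer.

Variables (gT : finGroupType) (G : {group gT}) (x : gT).
Hypotheses (Gx : x \in G) (ncx : x \notin 'Z(G)) (nabC : ~~ abelian 'C_G[x]).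

Let H := ('C_G[x])%G.
Let inner := [set 'C_G[h] | h in H].
Let outer := [set 'C_G[g] | g in G :\: H].

Let sHG : H \subset G. Proof. exact: subsetIl. Qed.

Let mem_cent a b : b \in G -> (b \in 'C_G[a]) = (b \in 'C[a]).
Proof. by rewrite inE => ->. Qed.

Let centHx h : h \in H -> x \in 'C[h].
Proof. by case/setIP=> _; rewrite cent1C. Qed.

(** The centralizers of elements of H contain x, and the others do not. *)
Lemma card_Cent_split : #|Cent G| = (#|inner| + #|outer|)%N.
Proof.
have ->: Cent G = inner :|: outer.
  by rewrite -imsetU -{1}(setIidPr sHG) setID.
apply/eqP; rewrite (leq_card_setU inner outer).2; rewrite -setI_eq0.
apply/eqP/setP=> C; rewrite !inE; apply/andP=> -[/imsetP[h Hh ->]].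
case/imsetP=> g /setDP[Gg Hg] eqC; case/negP: Hg.
have: x \in 'C_G[h] by rewrite mem_cent ?centHx.
by rewrite eqC mem_cent // [g \in H]mem_cent // cent1C.
Qed.

Let nabP : exists y1, exists y2, [/\ y1 \in H, y2 \in H & y2 \notin 'C[y1]].
Proof.
case/subsetPn: nabC => y1 Hy1 ncy1.
have /subsetPn[y2 Hy2 ncy2]: ~~ (H \subset 'C[y1]) by rewrite sub_cent1.
by exists y1, y2.
Qed.

Let outP : exists2 g, g \in G & g \notin 'C[x].
Proof.
have /subsetPn[g Gg ncg]: ~~ (G \subset 'C[x]).
  by rewrite sub_cent1; move: ncx; rewrite inE Gx.
by exists g.
Qed.

Let leq_inner (hs : seq gT) (ws : seq gT) :
    {subset hs <= H} ->
    uniq [seq [seq w \in 'C_G[h] | w <- ws] | h <- hs] ->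
  size hs <= #|inner|.
Proof.
move=> sH Us; rewrite -(size_map (fun h => 'C_G[h])).
apply: (@card_separated _ inner ws); last by rewrite -map_comp.
by move=> C /mapP[h hs_h ->]; apply: imset_f; apply: sH.
Qed.

Let Hx : x \in H.
Proof. by rewrite mem_cent ?cent1id. Qed.

Let memCx h : h \in H -> h \in 'C[x].
Proof. by move/centHx; rewrite cent1C. Qed.

(** The five are the centralizers of 1, x, y, y' and y y', for noncommuting y and
    y' in H; an element outside H tells the first two apart. *)
Lemma inner_ge5 : 5 <= #|inner|.
Proof.
have [y1 [y2 [Hy1 Hy2 nc12]]] := nabP; have [g Gg ncg] := outP.
have [Gy1 Gy2] := (subsetP sHG _ Hy1, subsetP sHG _ Hy2).
have nc21: y1 \notin 'C[y2] by rewrite cent1C.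
have sH: {subset [:: 1; x; y1; y2; y1 * y2] <= H}.
  by apply/allP; rewrite /= group1 Hx groupM // Hy1 Hy2.
apply: (leq_inner (ws := [:: g; y1; y2]) sH) => /=.
rewrite !mem_cent // !(cent1C _ 1) !group1 (negbTE ncg) !memCx // !cent1id.
rewrite [y1 \in 'C[_ * _]]cent1C [y2 \in 'C[_ * _]]cent1C.
rewrite (groupMl _ (cent1id y1)) (groupMr _ (cent1id y2)).
rewrite (negbTE nc12) (negbTE nc21).
by case: (g \in 'C[y1]); case: (g \in 'C[y2]); case: (g \in _).
Qed.

(** An element z of H that commutes with some g outside H yields a sixth
    centralizer. When z is central in H, it is C(z) itself, which contains H and
    g. Otherwise the noncommuting pair may be chosen to start with z, and then
    C(z) and C(z x) differ at g, since x does not commute with g. *)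
Lemma inner_ge6 z g :
    z \in H -> z \notin 'Z(G) -> g \in G -> g \notin 'C[x] -> g \in 'C[z] ->
  6 <= #|inner|.
Proof.
move=> Hz ncz Gg ncg cgz; have Gz := subsetP sHG _ Hz.
have [Zz | nZz] := boolP (z \in 'C(H)).
  have [y1 [y2 [Hy1 Hy2 nc12]]] := nabP.
  have [Gy1 Gy2] := (subsetP sHG _ Hy1, subsetP sHG _ Hy2).
  have nc21: y1 \notin 'C[y2] by rewrite cent1C.
  have memCz h : h \in H -> h \in 'C[z].
    by rewrite -sub_cent1 in Zz; apply: (subsetP Zz).
  have /subsetPn[w Gw ncw]: ~~ (G \subset 'C[z]).
    by rewrite sub_cent1; move: ncz; rewrite inE Gz.
  have sH: {subset [:: 1; x; z; y1; y2; y1 * y2] <= H}.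
    by apply/allP; rewrite /= group1 Hx groupM // Hy1 Hy2 Hz.
  apply: (leq_inner (ws := [:: g; y1; y2; w]) sH) => /=.
  rewrite !mem_cent // !(cent1C _ 1) !group1 (negbTE ncg) !cent1id.
  rewrite (memCx Hy1) (memCx Hy2) (memCz _ Hy1) (memCz _ Hy2) cgz (negbTE ncw).
  rewrite [y1 \in 'C[_ * _]]cent1C [y2 \in 'C[_ * _]]cent1C.
  rewrite (groupMl _ (cent1id y1)) (groupMr _ (cent1id y2)).
  rewrite (negbTE nc12) (negbTE nc21).
  case: (g \in 'C[y1]); case: (g \in 'C[y2]); case: (g \in _) => //;
  by case: (w \in 'C[y1]); case: (w \in 'C[y2]); case: (w \in 'C[x]);
     case: (w \in _).
have /subsetPn[y Hy ncy]: ~~ (H \subset 'C[z]) by rewrite sub_cent1.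
have Gy := subsetP sHG _ Hy.
have ncyz: z \notin 'C[y] by rewrite cent1C.
have sH: {subset [:: 1; x; z; z * x; y; z * y] <= H}.
  by apply/allP; rewrite /= group1 Hx !groupM // Hy Hz.
apply: (leq_inner (ws := [:: g; z; y]) sH) => /=.
rewrite !mem_cent // !(cent1C _ 1) !group1 (negbTE ncg) !memCx // !cent1id.
rewrite cgz [g \in 'C[z * x]]cent1C [z \in 'C[z * x]]cent1C.
rewrite [y \in 'C[z * x]]cent1C.
rewrite [z \in 'C[z * y]]cent1C [y \in 'C[z * y]]cent1C.
rewrite [z * y \in _]groupMl ?cent1id // [z * y \in _]groupMr ?cent1id //.
have czg: z \in 'C[g] by rewrite cent1C.
rewrite (groupMl _ czg) [x \in 'C[g]]cent1C (negbTE ncg).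
rewrite [z * x \in 'C[z]]groupMl ?cent1id // [x \in 'C[z]]centHx //.
rewrite [z * x \in 'C[y]]groupMr ?centHx // (negbTE ncy) (negbTE ncyz).
by case: (g \in 'C[y]); case: (g \in _).
Qed.

(** Any g lies in the center of its own centralizer. *)
Lemma outer_cover :
  #|G| - #|H| <= \sum_(C in outer) #|'Z(C) :\: H|.
Proof.
have <-: #|G :\: H| = #|G| - #|H| by rewrite cardsD (setIidPr sHG).
apply: leq_trans (leq_card_bigcup _ _); apply: subset_leq_card.
apply/subsetP=> g Og; have /setDP[Gg Hg] := Og.
apply/bigcupP; exists ('C_G[g]); first exact: imset_f.
rewrite in_setD Hg inE mem_cent // cent1id; apply/centP=> h /setIP[_ /cent1P chg].
exact: commute_sym.
Qed.

Let ltHG : #|H| < #|G|.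
Proof.
have [g Gg ncg] := outP; apply: proper_card.
by apply/properP; split=> //; exists g; rewrite // [g \in H]mem_cent.
Qed.

Lemma leq_outer m :
    (forall g, g \in G -> g \notin H ->
       m * #|'Z('C_G[g]) :\: H| <= #|G| - #|H|) ->
  m <= #|outer|.
Proof.
move=> bound; have gt0 : 0 < #|G| - #|H| by rewrite subn_gt0.
rewrite -(leq_pmul2r gt0) (leq_trans (leq_mul (leqnn m) outer_cover)) //.
rewrite big_distrr -sum_nat_const; apply: leq_sum => C /imsetP[g /setDP[Gg Hg] ->].
exact: bound.
Qed.

(** Four outer centralizers always exist by the index bound; if no noncentral
    element of H commutes with an element outside H, the groups Z(C(g)) meet H
    only in Z(G) and have index at least 8, so that eight of them exist. *)
Lemma card_Cent_nonabelian : 9 < #|Cent G|.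
Proof.
have sAG g : 'Z('C_G[g]) \subset G by rewrite !subIset ?subxx.
have idx g := mul_cardG_leq (sAG g) sHG.
have split g := cardsID H 'Z('C_G[g]).
rewrite card_Cent_split.
have outer4: 4 <= #|outer|.
  apply: leq_outer => g Gg Hg.
  apply: leq_outside (split g) (idx g) _; rewrite ?subset_leq_card //.
  exact: abelian_index_ge4 (sAG g) (center_abelian _) Gx ncx nabC.
have [/existsP[z] | none] :=
  boolP [exists z in H :\: 'Z(G), ~~ ('C_G[z] \subset H)].
  case/andP=> /setDP[Hz ncz] /subsetPn[g]; rewrite inE => /andP[Gg cgz].
  by rewrite mem_cent // => ncg; have := inner_ge6 Hz ncz Gg ncg cgz; lia.
suffices: 8 <= #|outer| by have := inner_ge5; lia.
apply: leq_outer => g Gg Hg.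
apply: leq_outside (split g) (idx g) _; rewrite ?subset_leq_card //.
have trivI: 'Z('C_G[g]) :&: H \subset 'Z(G).
  apply/subsetP=> z /setIP[/setIP[Cz _] Hz]; apply: contraR Hg => ncz.
  rewrite negb_exists in none; have := forallP none z.
  rewrite inE ncz Hz negbK /= => /subsetP-> //.
  by rewrite inE Gg cent1C; case/setIP: Cz.
have leH := card_nonabelian_cent1 Gx ncx nabC.
rewrite -(leq_pmul2r (cardG_gt0 ('Z('C_G[g]) :&: H))).
apply: leq_trans (idx g); rewrite mulnAC mulnC leq_mul2l.
by rewrite (leq_trans _ leH) ?orbT // leq_mul2l subset_leq_card.
Qed.

End NonabelianCentralizer.

(** * Frobenius groups with abelian kernel and complement *)

(** The complement is its own normalizer and meets the kernel trivially. *)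
Lemma card_Frobenius_conjugates (gT : finGroupType) (G K H : {group gT}) :
  [Frobenius G = K ><| H] -> #|H :^: K| = #|K|.
Proof.
move=> frobG; have [defG _ _ _ _] := Frobenius_context frobG.
have /andP[_ /and3P[_ _ /eqP NH]] := FrobeniusWcompl frobG.
have [_ /mulG_sub[sKG _] _ tiKH] := sdprodP defG.
have tN: 'N_K(H) = 1.
  rewrite -tiKH -{2}NH normD1 setICA setIA; congr (_ :&: _).
  by rewrite setIC (setIidPl sKG).
by rewrite card_conjugates tN indexg1.
Qed.

Section AbelianFrobenius.

Variables (gT : finGroupType) (Q K H : {group gT}).
Hypotheses (frobQ : [Frobenius Q = K ><| H]) (abK : abelian K) (abH : abelian H).

Lemma Frobenius_cent1_abelian_ker x : x \in K^# -> 'C_Q[x] = K.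
Proof.
move=> K1x; have [_ _ _ /proper_sub sKQ _] := Frobenius_context frobQ.
apply/eqP; rewrite eqEsubset (Frobenius_cent1_ker frobQ) //=.
by rewrite subsetI sKQ sub_cent1 (subsetP abK) //; case/setD1P: K1x.
Qed.

Lemma Frobenius_cent1_abelian_compl x : x \in H^# -> 'C_Q[x] = H.
Proof.
move=> H1x; have [_ _ _ _ /proper_sub sHQ] := Frobenius_context frobQ.
have /andP[_ tiH] := FrobeniusWcompl frobQ.
apply/eqP; rewrite eqEsubset (cent1_normedTI tiH) //=.
by rewrite subsetI sHQ sub_cent1 (subsetP abH) //; case/setD1P: H1x.
Qed.

Lemma Frobenius_cent1_abelian x :
    x \in Q -> x != 1 ->
  'C_Q[x] = K \/ exists2 k, k \in K & 'C_Q[x] = H :^ k.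
Proof.
move=> Qx ntx; have [_ _ _ /proper_sub sKQ _] := Frobenius_context frobQ.
have /and3P[/eqP covQ _ _] := Frobenius_partition frobQ.
have := Qx; rewrite -{1}covQ => /bigcupP[A].
case/setU1P=> [->{A} Kx | /imsetP[k Kk ->{A} Hkx]].
  by left; rewrite Frobenius_cent1_abelian_ker // !inE ntx.
right; exists k => //; have Qk := subsetP sKQ _ Kk.
move: Hkx; rewrite mem_conjg => H1y; set y := x ^ k^-1 in H1y.
have ->: x = y ^ k by rewrite conjgKV.
by rewrite cent1J -{1}(conjGid Qk) -conjIg Frobenius_cent1_abelian_compl.
Qed.

Lemma card_Cent_Frobenius : #|Cent Q| = #|K|.+2.
Proof.
have [defQ ntK ntH prKQ prHQ] := Frobenius_context frobQ.
have [_ /mulG_sub[sKQ sHQ] _ tiKH] := sdprodP defQ.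
have ->: Cent Q = (Q : {set gT}) |: ((K : {set gT}) |: (H :^: K)).
  apply/setP=> C; rewrite !in_setU1; apply/imsetP/or3P=> [[x Qx ->] | ].
    have [-> | ntx] := eqVneq x 1; first by constructor 1; rewrite cent11T setIT.
    have [-> | [k Kk ->]] := Frobenius_cent1_abelian Qx ntx.
      by constructor 2.
    by constructor 3; apply: imset_f.
  case=> [/eqP-> | /eqP-> | /imsetP[k Kk ->]].
  - by exists 1; rewrite ?cent11T ?setIT.
  - have [x Kx ntx] := trivgPn _ ntK; exists x; first exact: subsetP Kx.
    by rewrite Frobenius_cent1_abelian_ker // !inE ntx.
  have [h Hh nth] := trivgPn _ ntH; have Qk := subsetP sKQ _ Kk.
  exists (h ^ k); first by rewrite groupJ // (subsetP sHQ).
  rewrite cent1J -{1}(conjGid Qk) -conjIg.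
  by rewrite Frobenius_cent1_abelian_compl // !inE nth.
have KH : (K : {set gT}) \notin H :^: K.
  apply/imsetP=> -[k Kk defK]; case/negP: ntK.
  by rewrite -(setIid K) {2}defK -{1}(conjGid Kk) -conjIg tiKH conjs1g.
rewrite !cardsU1 KH (card_Frobenius_conjugates frobQ).
rewrite in_setU1 negb_or eq_sym (proper_neq prKQ) /=.
suffices ->: (Q : {set gT}) \notin H :^: K by [].
apply/imsetP=> -[k Kk defQH]; have /proper_card := prHQ.
by rewrite -(cardJg H k) -defQH ltnn.
Qed.

End AbelianFrobenius.

(** In groups of prime order, one nontrivial commuting pair would make H and K
    commute elementwise. *)
Lemma sdprod_Frobenius (gT : finGroupType) (Q K H : {group gT}) :
    K ><| H = Q -> prime #|K| -> prime #|H| -> ~~ (H \subset 'C(K)) ->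
  [Frobenius Q = K ><| H].
Proof.
move=> defQ prK prH ncHK.
apply/(Frobenius_semiregularP defQ); rewrite -?cardG_gt1 ?prime_gt1 //.
move=> x /setD1P[ntx Hx]; apply: prime_TIg => //.
rewrite sub_cent1; apply: contra ntx => cKx.
by rewrite -in_set1 -[[set 1]](prime_TIg prH ncHK) inE Hx.
Qed.

(** * Eight component orders *)

(** These are weak compositions: zero entries are allowed. *)
Fixpoint compositions (k n : nat) : seq (seq nat) :=
  if k is k'.+1 then
    flatten [seq [seq i :: s | s <- compositions k' (n - i)] | i <- iota 0 n.+1]
  else if n == 0 then [:: [::]] else [::].

Lemma mem_compositions (k n : nat) (s : seq nat) :
  size s = k -> sumn s = n -> s \in compositions k n.
Proof.
elim: k n s => [|k IHk] n [|i s] //.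
  by move=> _ <-.
move=> [sz_s] sum_s.
have lt_i: i < n.+1 by rewrite -sum_s /= ltnS leq_addr.
apply/flattenP; exists [seq i :: s' | s' <- compositions k (n - i)].
  by apply/mapP; exists i; rewrite // mem_iota.
by apply/mapP; exists s; rewrite // IHk // -sum_s /= addKn.
Qed.

(** A list s of six numbers stands for a multiset of orders between 2 and 7: its
    entry at position c - 2 is the multiplicity of c. The weight is the sum of F
    over the multiset. *)
Definition weight (F : nat -> nat) (s : seq nat) : nat :=
  sumn [seq (nth 0 s (c - 2) * F c)%N | c <- iota 2 6].

(** What is required of the component orders of a partition of a group of order q:
    each divides q, the orders of two components have product at most q, and for
    p = 2, 3, 5 the number of p-elements is a multiple of the p-part of q. Each p-part
    is a power with exponent [logn], which unlike [partn] can be computed by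
    evaluation. *)
Definition admissible (s : seq nat) : bool :=
  let q := (weight predn s).+1 in
  let n c := nth 0 s (c - 2) in
  [&& all (fun c => (0 < n c) ==> (c %| q)) (iota 2 6),
      all (fun c => all (fun d =>
             [&& 0 < n c, 0 < n d & (c == d) ==> (1 < n c)] ==> (c * d <= q))
           (iota 2 6)) (iota 2 6)
    & all (fun p => (p ^ logn p q)%N %|
             (weight (fun c => (p ^ logn p c)%N.-1) s).+1)
        [:: 2; 3; 5]%N].

(** The surviving orders are 14, 21, 42, 49 and 20; the list for 20 is excluded
    later by counting conjugates. *)
Lemma admissible_profiles :
  all (fun s => admissible s ==> (s \in
    [:: [:: 7; 0; 0; 0; 0; 1]; [:: 0; 7; 0; 0; 0; 1]; [:: 0; 0; 0; 0; 7; 1];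
        [:: 0; 0; 0; 0; 0; 8]; [:: 3; 0; 4; 1; 0; 0]]%N)) (compositions 6 8).
Proof. by vm_compute. Qed.

(** Once s is eliminated, the product bound reads (a - 7) * (q - a) <= 0. *)
Lemma leq7_of_part_sum (a s q : nat) :
  a < q -> s + a = q + 7 -> a * s <= 7 * q -> a <= 7.
Proof.
move=> lt_aq def_s; have ->: s = q - a + 7 by lia.
move=> le_as; rewrite leqNgt; apply/negP=> gt7.
have: 0 < (a - 7) * (q - a) by rewrite muln_gt0 !subn_gt0 gt7.
nia.
Qed.

(** * Partitions of a group into abelian subgroups *)

Section AbelianPartition.

Variables (gT : finGroupType) (Q : {group gT}) (P : {set {group gT}}).
Hypotheses (sPQ : {in P, forall A : {group gT}, A \subset Q})
           (abP : {in P, forall A : {group gT}, abelian A})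
           (ntP : {in P, forall A : {group gT}, A :!=: 1})
           (tiP : {in P &, forall (A B : {group gT}) x,
                   x \in A -> x \in B -> x != 1 -> A = B})
           (covP : {in Q, forall x : gT, x != 1 ->
                    exists2 A : {group gT}, A \in P & x \in A})
           (conjP : {in P & Q, forall (A : {group gT}) x, (A :^ x)%G \in P}).

Lemma part_TI A B : A \in P -> B \in P -> A != B -> A :&: B = 1.
Proof.
move=> PA PB neAB; apply/trivgP/subsetP=> x /setIP[Ax Bx].
by rewrite inE; apply: contraR neAB => ntx; rewrite (tiP PA PB Ax Bx ntx).
Qed.

Lemma card_part_section (S : {set gT}) :
  S \subset Q -> 1 \in S -> #|S| = (\sum_(A in P) #|A :&: S|.-1).+1.
Proof.
move=> sSQ S1; rewrite (cardsD1 1) S1 add1n; congr _.+1.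
have cardA (A : {group gT}) : #|A :&: S|.-1 = \sum_(x in S^#) (x \in A).
  rewrite -[RHS]/(\sum_(x in S^#) (if x \in A then 1 else 0)) -big_mkcondr.
  rewrite sum1dep_card (cardsD1 1) inE group1 S1 /=.
  by apply: eq_card => x; rewrite !inE -andbA [(x \in S) && _]andbC.
rewrite (eq_bigr _ (fun A _ => cardA A)) exchange_big /= -sum1_card.
apply: eq_bigr => x /setD1P[ntx Sx].
have [A PA Ax] := covP (subsetP sSQ _ Sx) ntx.
rewrite (bigD1 A) //= Ax big1 ?addn0 // => B /andP[PB neBA].
by apply/eqP; rewrite eqb0; apply: contra neBA => Bx; rewrite (tiP PB PA Bx Ax).
Qed.

(** By coprimality, the product x y generates a cyclic group that contains both x
    and y, and a cyclic group lies inside a single component. *)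
Lemma commuting_parts A B x y :
    A \in P -> B \in P -> A != B -> coprime #|A| #|B| ->
    x \in A -> x != 1 -> y \in B -> commute x y -> y = 1.
Proof.
move=> PA PB neAB coAB Ax ntx By cxy.
have [Qx Qy] := (subsetP (sPQ PA) _ Ax, subsetP (sPQ PB) _ By).
apply/eqP; apply: contraR neAB => nty.
have co_xy : coprime #[x] #[y].
  by apply: coprime_dvdl (order_dvdG Ax) (coprime_dvdr (order_dvdG By) coAB).
have def_xy := cycleM cxy co_xy.
have xyx : x \in <[x * y]> by rewrite def_xy (subsetP (mulG_subl _ _)) ?cycle_id.
have xyy : y \in <[x * y]> by rewrite def_xy (subsetP (mulG_subr _ _)) ?cycle_id.
have nt_xy : x * y != 1.
  by apply: contra ntx => /eqP xy1; move: xyx; rewrite xy1 cycle1 inE.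
have [C PC Cxy] := covP (groupM Qx Qy) nt_xy.
have sC z : z \in <[x * y]> -> z \in C by apply: subsetP; rewrite cycle_subG.
by rewrite (tiP PA PC Ax (sC _ xyx) ntx) (tiP PB PC By (sC _ xyy) nty).
Qed.

(** K is normal, being the only component of its order, and H acts on K without
    fixed points, since commuting elements of K and H would share a component. *)
Lemma part_Frobenius K H :
    K \in P -> H \in P -> {in P, forall A : {group gT}, #|A| = #|K| -> A = K} ->
    coprime #|K| #|H| -> #|Q| = (#|K| * #|H|)%N ->
  [Frobenius Q = K ><| H].
Proof.
move=> PK PH uniqK coKH oQ.
have tiKH : K :&: H = 1 := coprime_TIg coKH.
have neKH : K != H.
  by apply: contraTneq (ntP PK) => eqKH; rewrite negbK -tiKH -eqKH setIid.
have nKQ : Q \subset 'N(K).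
  apply/subsetP=> x Qx; rewrite inE.
  by have /(congr1 (@gval gT)) /= -> := uniqK _ (conjP PK Qx) (cardJg _ _).
have nKH := subset_trans (sPQ PH) nKQ.
have defQ : K ><| H = Q.
  rewrite sdprodE //; apply/eqP.
  by rewrite eqEcard mul_subG ?sPQ //= TI_cardMg // oQ.
apply/(Frobenius_semiregularP defQ (ntP PK) (ntP PH)) => y /setD1P[nty Hy].
apply/trivgP/subsetP=> x /setIP[Kx /cent1P cyx]; rewrite inE.
apply: contraR nty => ntx.
by rewrite (commuting_parts PK PH neKH coKH Kx ntx Hy).
Qed.

(** The p-elements of Q are the solutions of x ^ n = 1 for n the p-part of |Q|;
    in an abelian subgroup they form the Sylow p-subgroup. *)
Lemma card_Ldiv_abelian (A : {group gT}) (p : nat) :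
    A \subset Q -> abelian A -> #|A :&: 'Ldiv_(#|Q|`_p)(Q)| = (#|A|`_p)%N.
Proof.
move=> sAQ abA; have hallO := nilpotent_pcore_Hall p (abelian_nil abA).
rewrite -(card_Hall hallO); congr #|pred_of_set _|; apply/setP=> x.
have [Ax | nAx] := boolP (x \in A); last first.
  rewrite inE (negbTE nAx); apply/esym/negbTE; apply: contra nAx.
  exact: (subsetP (pcore_sub _ _)).
rewrite (mem_normal_Hall hallO (pcore_normal _ _) Ax) !inE Ax (subsetP sAQ) //=.
rewrite -order_dvdn; apply/idP/idP => [dvd_x | px].
  exact: pnat_dvd dvd_x (part_pnat _ _).
rewrite -(part_pnat_id px) partn_dvd ?cardG_gt0 //.
exact: order_dvdG (subsetP sAQ _ Ax).
Qed.

Lemma part_mul_leq A B : A \in P -> B \in P -> A != B -> #|A| * #|B| <= #|Q|.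
Proof.
move=> PA PB neAB; have := mul_cardG_leq (sPQ PA) (sPQ PB).
by rewrite part_TI // cards1 muln1.
Qed.

Lemma sum_part_orders : \sum_(A in P) #|A|.-1 = #|Q|.-1.
Proof.
rewrite (card_part_section (subxx Q) (group1 Q)) /=.
by apply: eq_bigr => A PA; rewrite (setIidPl (sPQ PA)).
Qed.

Hypotheses (nabQ : ~~ abelian Q) (P8 : #|P| = 8).

(** The other seven components have orders at most |Q| / |A|, and their sum is
    known. *)
Lemma part_order_leq7 A : A \in P -> 1 < #|A| <= 7.
Proof.
move=> PA; rewrite cardG_gt1 ntP //=.
have ltAQ: #|A| < #|Q|.
  apply: proper_card; rewrite properEneq sPQ // andbT.
  by apply: contra nabQ => /eqP <-; apply: abP.
apply: (leq7_of_part_sum ltAQ (s := \sum_(B in P :\ A) #|B|)); last first.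
  have <-: #|P :\ A| = 7 by have := cardsD1 A P; rewrite PA P8 => -[].
  rewrite big_distrr -sum_nat_const; apply: leq_sum => B /setD1P[neBA PB].
  by rewrite part_mul_leq // eq_sym.
rewrite addnC -(big_setD1 A PA).
have ->: \sum_(B in P) #|B| = \sum_(B in P) (#|B|.-1 + 1).
  by apply: eq_bigr => B _; rewrite addn1 prednK ?cardG_gt0.
rewrite big_split sum_part_orders sum1_card P8 /=.
by case: #|Q| (cardG_gt0 Q) => // m _; rewrite addSnnS.
Qed.

Let n (c : nat) := #|[set A : {group gT} in P | #|A| == c]|.
Let profile := [seq n c | c <- iota 2 6].

Let nth_profile (c : nat) : c \in iota 2 6 -> nth 0 profile (c - 2) = n c.
Proof.
by rewrite mem_iota => c26; rewrite (nth_map 0) ?size_iota ?nth_iota ?subnKC //; lia.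
Qed.

Lemma weight_profile F : weight F profile = \sum_(A in P) F #|A|.
Proof.
rewrite /weight sumnE big_map.
rewrite (eq_big_seq (fun c => \sum_(A in P | #|A| == c) F #|A|)) => [|c c26].
  rewrite (exchange_big_dep (fun A => A \in P)) => [|c A _ /andP[]] //=.
  apply: eq_bigr => A PA; rewrite /= !big_cons big_nil PA; move: (part_order_leq7 PA).
  by case: #|A| => [|[|[|[|[|[|[|[|m]]]]]]]] //= _; rewrite ?addn0.
rewrite nth_profile // -sum_nat_const; apply: eq_big => [A | A]; rewrite inE //.
by case/andP=> _ /eqP->.
Qed.

Lemma profile_admissible : admissible profile.
Proof.
have nP (c : nat) : 0 < n c -> exists2 A, A \in P & #|A| = c.
  by case/card_gt0P=> A; rewrite inE => /andP[PA /eqP]; exists A.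
have oQ : (weight predn profile).+1 = #|Q|.
  by rewrite weight_profile sum_part_orders prednK.
rewrite /admissible oQ; apply/and3P; split.
- apply/allP=> c c26; rewrite nth_profile //; apply/implyP=> /nP[A PA <-].
  by rewrite cardSg ?sPQ.
- apply/allP=> c c26; apply/allP=> d d26; rewrite !nth_profile //.
  apply/implyP=> /and3P[/nP[A PA oA] /nP[B PB oB]].
  have [eqcd /= | neqcd _] := eqVneq c d.
    case/card_gt1P=> A1 [A2 []]; rewrite !inE => /andP[PA1 /eqP oA1].
    by case/andP=> PA2 /eqP oA2 neA; rewrite -eqcd -{1}oA1 -oA2 part_mul_leq.
  rewrite -oA -oB part_mul_leq //; apply: contraNneq neqcd => eqAB.
  by rewrite -oA -oB eqAB.
apply/allP=> p _; rewrite -p_part weight_profile.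
have ->: \sum_(A in P) (p ^ logn p #|A|)%N.-1
         = \sum_(A in P) #|A :&: 'Ldiv_(#|Q|`_p)(Q)|.-1.
  by apply: eq_bigr => A PA; rewrite card_Ldiv_abelian ?sPQ ?abP // p_part.
rewrite -card_part_section ?subsetIl //; last by rewrite !inE group1 expg1n eqxx.
exact: Frobenius_Ldiv (dvdn_part _ _).
Qed.

Lemma part_Frobenius_count (c d : nat) :
    n c = 1%N -> 0 < n d -> coprime c d -> #|Q| = (c * d)%N ->
  exists K H : {group gT},
    [/\ H \in P, #|K| = c, #|H| = d & [Frobenius Q = K ><| H]].
Proof.
move=> nc1 /card_gt0P[H]; rewrite inE => /andP[PH /eqP oH] co_cd oQ.
have /eqP/cards1P[K defK] := nc1.
have := set11 K; rewrite -defK inE => /andP[PK /eqP oK].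
exists K, H; split=> //; apply: part_Frobenius; rewrite ?oK ?oH // => A PA oA.
by apply/set1P; rewrite -defK inE PA oA eqxx.
Qed.

Lemma abelian_partition8 :
  exists K H : {group gT},
    [/\ [Frobenius Q = K ><| H], #|K| = 7, abelian H & #|H| \in [:: 2; 3; 6]%N].
Proof.
have oQ: #|Q| = (weight predn profile).+1.
  by rewrite weight_profile sum_part_orders prednK.
have sum8: sumn profile = 8.
  transitivity (weight (fun => 1%N) profile); first by rewrite /weight /= !muln1.
  by rewrite weight_profile sum1_card.
have := allP admissible_profiles _ (mem_compositions (erefl : size profile = 6) sum8).
rewrite profile_admissible /= !inE => profile_in.
have frob7 k : n 7 = 1%N -> 0 < n k -> #|Q| = (7 * k)%N -> k \in [:: 2; 3; 6]%N ->
  exists K H : {group gT},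
    [/\ [Frobenius Q = K ><| H], #|K| = 7, abelian H & #|H| \in [:: 2; 3; 6]%N].
- move=> n7 nk oQ7 k_in; have co7k: coprime 7 k.
    by move: k_in; rewrite !inE => /or3P[]/eqP->.
  have [K [H [PH oK oH frobQ]]] := part_Frobenius_count n7 nk co7k oQ7.
  by exists K, H; rewrite oH; split=> //; apply: abP.
case/or4P: profile_in => [||| /orP[]] /eqP def_p; rewrite def_p in oQ;
  case: def_p => n2 n3 n4 n5 n6 n7.
- by apply: (frob7 2%N); rewrite ?n2.
- by apply: (frob7 3%N); rewrite ?n3.
- by apply: (frob7 6%N); rewrite ?n6.
- by case/negP: nabQ; apply: (@card_p2group_abelian _ 7).
(* The remaining profile, of order 20: the five conjugates of a component of
   order 4 are components of order 4, but there are only four of these. *)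
have [|||K [H [PH oK oH frobQ]]] := @part_Frobenius_count 5 4 n5; rewrite ?n4 //.
suffices: 5 <= n 4 by rewrite n4.
rewrite -oK -(card_Frobenius_conjugates frobQ).
apply: leq_trans (leq_imset_card (@gval gT) _); apply: subset_leq_card.
apply/subsetP=> _ /imsetP[x Kx ->]; apply/imsetP; exists (H :^ x)%G => //.
rewrite inE cardJg oH eqxx conjP //.
have [/sdprodW/mulG_sub[sKQ _] _ _ _ _] := Frobenius_context frobQ.
by rewrite (subsetP sKQ).
Qed.

End AbelianPartition.

(** * Centralizers modulo the center *)

Section CentralQuotient.

Variables (gT : finGroupType) (G : {group gT}).

Lemma center_normal_cent1 x : x \in G -> 'Z(G) <| 'C_G[x].
Proof.
move=> Gx; apply: (normalS _ (subsetIl _ _) (center_normal G)).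
by apply: setIS; rewrite /= -cent_set1 centS // sub1set.
Qed.

Lemma quotient_cent1_inj x y : x \in G -> y \in G ->
  'C_G[x] / 'Z(G) = 'C_G[y] / 'Z(G) -> 'C_G[x] = 'C_G[y].
Proof.
move=> Gx Gy eq_xy.
rewrite -(quotientGK (center_normal_cent1 Gx)) eq_xy.
by rewrite quotientGK ?center_normal_cent1.
Qed.

Lemma mem_quotient_cent1 x y : x \in G -> y \in G ->
  (coset 'Z(G) y \in 'C_G[x] / 'Z(G)) = (y \in 'C_G[x]).
Proof.
move=> Gx Gy; have Ny := subsetP (normal_norm (center_normal G)) y Gy.
by rewrite -{2}(quotientGK (center_normal_cent1 Gx)) inE Ny inE.
Qed.

(** A subgroup that is cyclic modulo the center is abelian, so the preimage of
    each proper centralizer of G / 'Z(G) centralizes all its elements. *)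
Lemma card_Cent_quotient :
    {in (G / 'Z(G))^#, forall u, cyclic 'C_(G / 'Z(G))[u]} ->
  #|Cent G| = #|Cent (G / 'Z(G))|.
Proof.
move=> cycC; have nZG := normal_norm (center_normal G).
have defC x : x \in G -> 'C_G[x] / 'Z(G) = 'C_(G / 'Z(G))[coset 'Z(G) x].
  move=> Gx; have Nx := subsetP nZG x Gx; apply/eqP.
  rewrite eqEsubset quotient_subcent1 /=.
  have [Zx | nZx] := boolP (x \in 'Z(G)).
    rewrite coset_id // cent11T setIT quotientS // subsetI subxx sub_cent1.
    by case/setIP: Zx.
  set u := coset _ x; have ntu: u \in (G / 'Z(G))^#.
    by rewrite !inE mem_quotient // andbT; apply: contra nZx => /eqP/coset_idr->.
  pose E := coset 'Z(G) @*^-1 'C_(G / 'Z(G))[u].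
  have sEG: E \subset G.
    by rewrite -(quotientGK (center_normal G)) morphpreS ?subsetIl.
  have sZE: 'Z(G) \subset E by rewrite -{1}(ker_coset 'Z(G)) kerE morphpreS // sub1G.
  have abE: abelian E.
    apply: (@cyclic_factor_abelian _ ('Z(G))%G); last by rewrite /= cosetpreK cycC.
    by rewrite subsetI sZE (subset_trans (subsetIr _ _)) ?centS.
  have Ex: x \in E.
    by rewrite mem_morphpre // inE cent1id andbT mem_quotient.
  rewrite -(cosetpreK 'C_(G / 'Z(G))[u]) quotientS //.
  by rewrite subsetI sEG sub_cent1 (subsetP abE).
have ->: Cent (G / 'Z(G)) = [set C / 'Z(G) | C : {set gT} in Cent G].
  rewrite -imset_comp; apply/setP=> C; apply/imsetP/imsetP=> [[u] | [x Gx ->]].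
    by case/morphimP=> x Nx Gx -> ->; exists x; rewrite //= defC.
  by exists (coset 'Z(G) x); rewrite ?mem_quotient //= defC.
rewrite [RHS]card_in_imset // => _ _ /imsetP[x Gx ->] /imsetP[y Gy ->].
exact: quotient_cent1_inj.
Qed.

Lemma abelian_cent1_eq x y :
    abelian 'C_G[x] -> abelian 'C_G[y] -> x \in G -> y \in 'C_G[x] ->
  'C_G[x] = 'C_G[y].
Proof.
move=> abx aby Gx Cxy; have [Gy cxy] := setIP Cxy.
have sub a b : abelian 'C_G[a] -> b \in 'C_G[a] -> 'C_G[a] \subset 'C_G[b].
  by move=> aba Cab; rewrite subsetI subsetIl sub_cent1 (subsetP aba).
by apply/eqP; rewrite eqEsubset !sub // inE Gx cent1C.
Qed.

(** The images of the eight proper centralizers form a partition of G / 'Z(G). *)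
Lemma Frobenius_of_Cent9 :
    #|Cent G| = 9 -> ~~ abelian (G / 'Z(G)) ->
  exists K H : {group coset_of 'Z(G)},
    [/\ [Frobenius G / 'Z(G) = K ><| H], #|K| = 7, abelian H
      & #|H| \in [:: 2; 3; 6]%N].
Proof.
move=> card9 nabQ; have nZG := normal_norm (center_normal G).
have abC x : x \in G :\: 'Z(G) -> abelian 'C_G[x].
  case/setDP=> Gx nZx; apply: contraT => nabC.
  by have := card_Cent_nonabelian Gx nZx nabC; rewrite card9.
pose P := [set ('C_G[x] / 'Z(G))%G | x in G :\: 'Z(G)].
apply: (@abelian_partition8 _ (G / 'Z(G))%G P) => //.
- by move=> _ /imsetP[x _ ->]; rewrite quotientS ?subsetIl.
- by move=> _ /imsetP[x Gx ->]; rewrite quotient_abelian ?abC.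
- move=> _ /imsetP[x /setDP[Gx nZx] ->] /=; apply: contra nZx => /eqP C1.
  have: coset 'Z(G) x \in 'C_G[x] / 'Z(G).
    by rewrite mem_quotient_cent1 // inE Gx cent1id.
  by rewrite C1 => /set1P/coset_idr->; rewrite ?(subsetP nZG).
- move=> _ _ /imsetP[x GZx ->] /imsetP[y GZy ->] u /=.
  case/morphimP=> z Nz /setIP[Gz cxz] -> Cyz ntz.
  have [Gx _] := setDP GZx; have [Gy _] := setDP GZy.
  have GZz: z \in G :\: 'Z(G).
    by rewrite inE Gz andbT; apply: contra ntz => Zz; rewrite /= coset_id.
  rewrite /= mem_quotient_cent1 // in Cyz; apply: val_inj => /=.
  rewrite (@abelian_cent1_eq x z) ?abC //; last by rewrite inE Gz.
  by rewrite -(@abelian_cent1_eq y z) ?abC.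
- move=> _ /morphimP[z Nz Gz ->] ntz; exists ('C_G[z] / 'Z(G))%G; last first.
    by rewrite mem_quotient // inE Gz cent1id.
  apply: (imset_f (fun x => ('C_G[x] / 'Z(G))%G)); apply/setDP; split=> //.
  by apply: contra ntz => Zz; rewrite /= coset_id.
- move=> _ _ /imsetP[x /setDP[Gx nZx] ->] /morphimP[g Ng Gg ->].
  apply/imsetP; exists (x ^ g).
    by apply/setDP; rewrite groupJ // memJ_norm.
  by apply: val_inj; rewrite /= -quotientJ // conjIg conjGid // cent1J.
have CentG: (G : {set gT}) \in Cent G.
  by apply/imsetP; exists 1; rewrite ?cent11T ?setIT.
have proper_Cent x : x \in G -> ('C_G[x] != G) = (x \notin 'Z(G)).
  by move=> Gx; rewrite inE Gx -sub_cent1 (sameP setIidPl eqP).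
have defP:
  [set gval A | A in P] =
    [set C / 'Z(G) | C : {set gT} in Cent G :\ (G : {set gT})].
  rewrite -imset_comp; apply/setP=> C; apply/imsetP/imsetP.
    case=> x /setDP[Gx nZx] ->; exists 'C_G[x] => //.
    by rewrite in_setD1 proper_Cent ?nZx //; apply: imset_f.
  case=> D /setD1P[ntD /imsetP[x Gx defD]] ->; exists x; rewrite /= -?defD //.
  by apply/setDP; rewrite -proper_Cent // -defD.
rewrite -(card_imset (mem P) (@group_inj _)) defP card_in_imset.
  by have := cardsD1 (G : {set gT}) (Cent G); rewrite card9 CentG => -[].
move=> C D /setD1P[_ /imsetP[x Gx ->]] /setD1P[_ /imsetP[y Gy ->]].
exact: quotient_cent1_inj.
Qed.

End CentralQuotient.

(** * Groups with nine centralizers *)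

Lemma abelian6_cyclic (gT : finGroupType) (H : {group gT}) :
  abelian H -> #|H| = 6 -> cyclic H.
Proof.
move=> abH oH.
have [||x Hx ox] := @Cauchy _ 2 H; rewrite ?oH //.
have [||y Hy oy] := @Cauchy _ 3 H; rewrite ?oH //.
apply/cyclicP; exists (x * y); apply/eqP.
rewrite eq_sym eqEcard cycle_subG groupM //= oH -orderE orderM ?ox ?oy //.
exact: (centsP abH).
Qed.

Lemma primitive_centralizer_Frobenius (gT : finGroupType) (G : {group gT})
    (K H : {group coset_of 'Z(G)}) :
    [Frobenius G / 'Z(G) = K ><| H] -> cyclic K -> cyclic H -> #|K| = 7 ->
  primitive_centralizer 9 G.
Proof.
move=> frobQ cycK cycH oK.
have [abK abH] := (cyclic_abelian cycK, cyclic_abelian cycH).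
have cardQ: #|Cent (G / 'Z(G))| = 9.
  by rewrite (card_Cent_Frobenius frobQ) // oK.
split=> //; rewrite card_Cent_quotient // => u /setD1P[ntu Qu].
have [-> //|[k Kk ->]] := Frobenius_cent1_abelian frobQ abK abH Qu ntu.
by rewrite cyclicJ.
Qed.

Lemma Cent_abelian (gT : finGroupType) (G : {group gT}) :
  abelian G -> #|Cent G| = 1%N.
Proof.
move=> abG; apply/eqP/cards1P; exists (G : {set gT}).
apply/setP=> C; rewrite inE; apply/imsetP/eqP=> [[x Gx ->] | ->].
  by apply/setIidPl; rewrite sub_cent1 (subsetP abG).
by exists 1; rewrite ?cent11T ?setIT.
Qed.

Unset Implicit Arguments.

Theorem theorem2p2 (gT : finGroupType) (G : {group gT}) :
  primitive_centralizer 9 G <->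
  [\/ is_cyclic_sdprod 7 2 (G / 'Z(G)),
      is_cyclic_sdprod 7 3 (G / 'Z(G))
    | is_cyclic_Frobenius 6 7 (G / 'Z(G))].
Proof.
split=> [[card9 cardQ9] | ].
  have nabQ: ~~ abelian (G / 'Z(G)).
    by apply/negP=> abQ; move: cardQ9; rewrite Cent_abelian.
  have [K [H [frobQ oK abH]]] := Frobenius_of_Cent9 card9 nabQ.
  have cycK: cyclic K by rewrite prime_cyclic ?oK.
  have [defQ ntK ntH _ _] := Frobenius_context frobQ.
  have ncHK: ~~ (H \subset 'C(K)).
    rewrite centsC; apply: contra ntK => cKH.
    by rewrite -(Frobenius_trivg_cent frobQ) (setIidPl cKH).
  rewrite !inE => /or3P[]/eqP oH; [constructor 1 | constructor 2 | constructor 3].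
  - by exists K, H; split=> //; rewrite prime_cyclic oH.
  - by exists K, H; split=> //; rewrite prime_cyclic oH.
  - by exists K, H; split=> //; rewrite abelian6_cyclic.
have sd p :
  prime p -> is_cyclic_sdprod 7 p (G / 'Z(G)) -> primitive_centralizer 9 G.
  move=> pr_p [K [H [defQ [cycK oK] [cycH oH] ncHK]]].
  apply: (primitive_centralizer_Frobenius _ cycK cycH oK).
  by apply: sdprod_Frobenius; rewrite ?oK ?oH.
case=> [||[K [H [frobQ [cycK oK] [cycH _]]]]]; [exact: sd | exact: sd |].
exact: primitive_centralizer_Frobenius frobQ cycK cycH oK.
Qed.
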